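(* Let $\mathcal{C}$ be a modular category with $\dim(X)>0$ for every simple object $X$, and suppose that the rank $n$ of $\mathcal{C}$ is odd and that the only simple object of $\mathcal{C}$ (up to isomorphism) that is isomorphic to its dual is the unit object $\mathbf{1}$. Then $\mathcal{C}$ is integral, i.e. $\dim(X)\in\mathbb{Z}$ for every simple object $X$ of $\mathcal{C}$.
   Context: A modular category is a finite semisimple $\mathbb{C}$-linear rigid braided balanced (ribbon) monoidal category with simple unit object $\mathbf{1}$ whose $S$-matrix is invertible. Its rank is the number $n$ of isomorphism classes of simple objects, with representatives $\mathbf{1}=X_0,X_1,\ldots,X_{n-1}$. $\dim(X)$ denotes the categorical (quantum) dimension with respect to the ribbon structure. The $S$-matrix is $\tilde S=(\tilde s_{ij})$, where $\theta_i\theta_j\tilde s_{ij}=\sum_k N_{i^*,j}^k\dim(X_k)\theta_k$, $\theta_i$ is the twist of $X_i$, $X_{i^*}=X_i^*$ is the dual of $X_i$, and $N_{i,j}^k=\dim\mathrm{Hom}(X_i\otimes X_j,X_k)$; in particular $\tilde s_{0i}=\dim(X_i)$. The condition that $\dim(X)>0$ for every simple object $X$ is called pseudo-unitarity. *)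

(* Defs.v *)
From mathcomp Require Import all_boot all_order all_algebra complex.
From mathcomp Require Import boolp classical_sets reals.

Set Implicit Arguments.
Unset Strict Implicit.
Unset Printing Implicit Defensive.

Import Order.TTheory GRing.Theory Num.Theory.
Local Open Scope ring_scope.

Declare Scope cat_scope.
Delimit Scope cat_scope with cat.
Local Open Scope cat_scope.

Reserved Notation "g \oc f" (at level 41, right associativity).
Reserved Notation "X ⊗ Y" (at level 40, left associativity).
Reserved Notation "f ⊠ g" (at level 40, left associativity).

(* K-linear categories with finite-dimensional morphism spaces; compositions  *)
(* are written in the usual order: g \oc f is "g after f".                    *)
Record linearCategory (K : fieldType) := LinearCategory {
  obj :> Type;
  hom : obj -> obj -> vectType K;
  idm : forall X, hom X X;
  comp : forall X Y Z, hom Y Z -> hom X Y -> hom X Z;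
  compA : forall W X Y Z (h : hom Y Z) (g : hom X Y) (f : hom W X),
    comp h (comp g f) = comp (comp h g) f;
  comp1m : forall X Y (f : hom X Y), comp (idm Y) f = f;
  compm1 : forall X Y (f : hom X Y), comp f (idm X) = f;
  comp_linearl : forall X Y Z (a : K) (g g' : hom Y Z) (f : hom X Y),
    comp (a *: g + g') f = a *: comp g f + comp g' f;
  comp_linearr : forall X Y Z (a : K) (g : hom Y Z) (f f' : hom X Y),
    comp g (a *: f + f') = a *: comp g f + comp g f'
}.

Arguments hom {K l} X Y.
Arguments idm {K l} X.
Arguments comp {K l X Y Z} g f.

Notation "g \oc f" := (comp g f) : cat_scope.

Section LinearCategoryNotions.
Variables (K : fieldType) (C : linearCategory K).
Implicit Types X Y Z : C.

Definition mutual_inverse X Y (f : hom X Y) (g : hom Y X) : Prop :=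
  g \oc f = idm X /\ f \oc g = idm Y.

Definition is_iso X Y (f : hom X Y) : Prop := exists g, mutual_inverse f g.

Definition isomorphic X Y : Prop := exists f : hom X Y, is_iso f.

Definition is_mono X Y (f : hom X Y) : Prop :=
  forall Z (g h : hom Z X), f \oc g = f \oc h -> g = h.

Definition is_epi X Y (f : hom X Y) : Prop :=
  forall Z (g h : hom Y Z), g \oc f = h \oc f -> g = h.

Definition is_kernel X Y Z (k : hom X Y) (f : hom Y Z) : Prop :=
  f \oc k = 0 /\
  forall W (g : hom W Y), f \oc g = 0 -> exists! h : hom W X, k \oc h = g.

Definition is_cokernel X Y Z (q : hom Y Z) (f : hom X Y) : Prop :=
  q \oc f = 0 /\
  forall W (g : hom Y W), g \oc f = 0 -> exists! h : hom Z W, h \oc q = g.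

(* Z is the direct sum of the X i; for m = 0 this says that Z is a zero       *)
(* object.                                                                    *)
Definition is_direct_sum m (X : 'I_m -> C) Z : Prop :=
  exists (inj : forall i, hom (X i) Z) (proj : forall i, hom Z (X i)),
    [/\ forall i, proj i \oc inj i = idm (X i),
        forall i j, i != j -> proj j \oc inj i = 0
      & \sum_i inj i \oc proj i = idm Z].

Definition abelian_category : Prop :=
  [/\ forall m (X : 'I_m -> C), exists Z, is_direct_sum X Z,
      forall X Y (f : hom X Y), exists Z (k : hom Z X), is_kernel k f,
      forall X Y (f : hom X Y), exists Z (q : hom Y Z), is_cokernel q f,
      forall X Y (k : hom X Y), is_mono k ->
        exists Z (f : hom Y Z), is_kernel k f
    & forall X Y (q : hom X Y), is_epi q ->
        exists Z (f : hom Z X), is_cokernel q f].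

(* X is nonzero and its only subobjects are 0 and X; a monomorphism is the    *)
(* zero morphism exactly when its source is a zero object.                    *)
Definition simple_object X : Prop :=
  idm X <> 0 /\
  forall Y (f : hom Y X), is_mono f -> f = 0 \/ is_iso f.

Definition semisimple_category : Prop :=
  abelian_category /\
  forall Z, exists m (X : 'I_m -> C),
    (forall i, simple_object (X i)) /\ is_direct_sum X Z.

Definition simple_representatives n (X : 'I_n -> C) : Prop :=
  [/\ forall i, simple_object (X i),
      forall i j, isomorphic (X i) (X j) -> i = j
    & forall Y, simple_object Y -> exists i, isomorphic Y (X i)].

Definition has_rank n : Prop :=
  exists X : 'I_n -> C, simple_representatives X.

(* The scalar t such that f = t id, when there is one. By Schur's lemma it    *)
(* exists, and is unique, when X is simple and K is algebraically closed.     *)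
Definition scalar_of X (f : hom X X) : K :=
  xget 0 [set t | f = t *: idm X]%classic.

End LinearCategoryNotions.

Record monoidalCategory (K : fieldType) := MonoidalCategory {
  mon_cat :> linearCategory K;
  unit_obj : mon_cat;
  tensor : mon_cat -> mon_cat -> mon_cat;
  tensorm : forall X X' Y Y' : mon_cat,
    hom X X' -> hom Y Y' -> hom (tensor X Y) (tensor X' Y');
  tensorm1 : forall X Y : mon_cat,
    tensorm (idm X) (idm Y) = idm (tensor X Y);
  tensorm_comp : forall (X X' X'' Y Y' Y'' : mon_cat)
      (f' : hom X' X'') (f : hom X X') (g' : hom Y' Y'') (g : hom Y Y'),
    tensorm (f' \oc f) (g' \oc g) = tensorm f' g' \oc tensorm f g;
  tensorm_linearl : forall (X X' Y Y' : mon_cat) (a : K)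
      (f f' : hom X X') (g : hom Y Y'),
    tensorm (a *: f + f') g = a *: tensorm f g + tensorm f' g;
  tensorm_linearr : forall (X X' Y Y' : mon_cat) (a : K)
      (f : hom X X') (g g' : hom Y Y'),
    tensorm f (a *: g + g') = a *: tensorm f g + tensorm f g';
  assoc : forall X Y Z : mon_cat,
    hom (tensor (tensor X Y) Z) (tensor X (tensor Y Z));
  assoc_inv : forall X Y Z : mon_cat,
    hom (tensor X (tensor Y Z)) (tensor (tensor X Y) Z);
  unitl : forall X : mon_cat, hom (tensor unit_obj X) X;
  unitl_inv : forall X : mon_cat, hom X (tensor unit_obj X);
  unitr : forall X : mon_cat, hom (tensor X unit_obj) X;
  unitr_inv : forall X : mon_cat, hom X (tensor X unit_obj);
  assocK : forall X Y Z, mutual_inverse (assoc X Y Z) (assoc_inv X Y Z);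
  unitlK : forall X, mutual_inverse (unitl X) (unitl_inv X);
  unitrK : forall X, mutual_inverse (unitr X) (unitr_inv X);
  assoc_natural : forall (X X' Y Y' Z Z' : mon_cat)
      (f : hom X X') (g : hom Y Y') (h : hom Z Z'),
    assoc X' Y' Z' \oc tensorm (tensorm f g) h
    = tensorm f (tensorm g h) \oc assoc X Y Z;
  unitl_natural : forall (X Y : mon_cat) (f : hom X Y),
    unitl Y \oc tensorm (idm unit_obj) f = f \oc unitl X;
  unitr_natural : forall (X Y : mon_cat) (f : hom X Y),
    unitr Y \oc tensorm f (idm unit_obj) = f \oc unitr X;
  pentagon : forall W X Y Z : mon_cat,
    assoc W X (tensor Y Z) \oc assoc (tensor W X) Y Z
    = tensorm (idm W) (assoc X Y Z) \oc assoc W (tensor X Y) Z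
        \oc tensorm (assoc W X Y) (idm Z);
  triangle : forall X Y : mon_cat,
    tensorm (idm X) (unitl Y) \oc assoc X unit_obj Y
    = tensorm (unitr X) (idm Y)
}.

Arguments unit_obj {K m}.
Arguments tensor {K m} X Y.
Arguments tensorm {K m X X' Y Y'} f g.
Arguments assoc {K m} X Y Z.
Arguments assoc_inv {K m} X Y Z.
Arguments unitl {K m} X.
Arguments unitl_inv {K m} X.
Arguments unitr {K m} X.
Arguments unitr_inv {K m} X.

Notation "X ⊗ Y" := (tensor X Y) : cat_scope.
Notation "f ⊠ g" := (tensorm f g) : cat_scope.
Notation "𝟙" := unit_obj : cat_scope.

Definition is_left_dual (K : fieldType) (C : monoidalCategory K) (X D : C)
    (ev : hom (D ⊗ X) 𝟙) (coev : hom 𝟙 (X ⊗ D)) : Prop :=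
  unitr X \oc (idm X ⊠ ev) \oc assoc X D X \oc (coev ⊠ idm X) \oc unitl_inv X
    = idm X /\
  unitl D \oc (ev ⊠ idm D) \oc assoc_inv D X D \oc (idm D ⊠ coev)
      \oc unitr_inv D
    = idm D.

(* Left duals are chosen and denote X^*; right duals are only required to     *)
(* exist.                                                                     *)
Record rigidCategory (K : fieldType) := RigidCategory {
  rig_cat :> monoidalCategory K;
  dual : rig_cat -> rig_cat;
  ev : forall X, hom (dual X ⊗ X) 𝟙;
  coev : forall X, hom 𝟙 (X ⊗ dual X);
  dualP : forall X, is_left_dual (ev X) (coev X);
  rdualP : forall X : rig_cat, exists (D : rig_cat)
    (e : hom (X ⊗ D) 𝟙) (c : hom 𝟙 (D ⊗ X)), is_left_dual e c
}.

Arguments dual {K r} X.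
Arguments ev {K r} X.
Arguments coev {K r} X.

Definition dualm (K : fieldType) (C : rigidCategory K) (X Y : C)
    (f : hom X Y) : hom (dual Y) (dual X) :=
  unitl (dual X) \oc (ev Y ⊠ idm (dual X))
    \oc ((idm (dual Y) ⊠ f) ⊠ idm (dual X))
    \oc assoc_inv (dual Y) X (dual X)
    \oc (idm (dual Y) ⊠ coev X) \oc unitr_inv (dual Y).

Record ribbonCategory (K : fieldType) := RibbonCategory {
  rib_cat :> rigidCategory K;
  braid : forall X Y : rib_cat, hom (X ⊗ Y) (Y ⊗ X);
  braid_iso : forall X Y, is_iso (braid X Y);
  braid_natural : forall (X X' Y Y' : rib_cat) (f : hom X X') (g : hom Y Y'),
    braid X' Y' \oc (f ⊠ g) = (g ⊠ f) \oc braid X Y;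
  hexagonl : forall X Y Z : rib_cat,
    assoc Y Z X \oc braid X (Y ⊗ Z) \oc assoc X Y Z
    = (idm Y ⊠ braid X Z) \oc assoc Y X Z \oc (braid X Y ⊠ idm Z);
  hexagonr : forall X Y Z : rib_cat,
    assoc_inv Z X Y \oc braid (X ⊗ Y) Z \oc assoc_inv X Y Z
    = (braid X Z ⊠ idm Y) \oc assoc_inv X Z Y \oc (idm X ⊠ braid Y Z);
  twist : forall X : rib_cat, hom X X;
  twist_iso : forall X, is_iso (twist X);
  twist_natural : forall (X Y : rib_cat) (f : hom X Y),
    twist Y \oc f = f \oc twist X;
  twist_tensor : forall X Y : rib_cat,
    twist (X ⊗ Y) = braid Y X \oc braid X Y \oc (twist X ⊠ twist Y);
  twist_dual : forall X : rib_cat, twist (dual X) = dualm (twist X)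
}.

Arguments braid {K r} X Y.
Arguments twist {K r} X.

Section RibbonNotions.
Variables (K : fieldType) (C : ribbonCategory K).
Implicit Types X Y Z : C.

Definition qtrace X (f : hom X X) : hom (𝟙 : C) 𝟙 :=
  ev X \oc braid X (dual X) \oc ((twist X \oc f) ⊠ idm (dual X)) \oc coev X.

Definition qdim X : K := scalar_of (qtrace (idm X)).

Definition theta X : K := scalar_of (twist X).

Definition fusion_coef X Y Z : nat := \dim {: hom (X ⊗ Y) Z}.

(* theta_i theta_j s_ij = \sum_k N_{i^*,j}^k dim(X_k) theta_k                 *)
Definition Smatrix n (X : 'I_n -> C) : 'M[K]_n :=
  \matrix_(i, j) ((theta (X i) * theta (X j))^-1 *
    \sum_k (fusion_coef (dual (X i)) (X j) (X k))%:R
             * qdim (X k) * theta (X k)).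

End RibbonNotions.

(* Invertibility of the S-matrix does not depend on the choice or the order   *)
(* of the representatives, so it is required for all of them.                 *)
Record modularCategory (R : realType) := ModularCategory {
  modular_cat :> ribbonCategory R[i];
  modular_semisimple : semisimple_category modular_cat;
  modular_finite : exists n, has_rank modular_cat n;
  modular_unit_simple : simple_object (𝟙 : modular_cat);
  modular_Smatrix : forall n (X : 'I_n -> modular_cat),
    simple_representatives X -> Smatrix X \in unitmx
}.

(* Main.v *)
From HB Require Import structures.
From mathcomp Require Import all_boot all_order all_algebra all_field complex ring.
From mathcomp Require Import boolp classical_sets reals.
Require Import Defs.

Set Implicit Arguments.
Unset Strict Implicit.
Unset Printing Implicit Defensive.

Import Order.TTheory GRing.Theory Num.Theory.
Local Open Scope ring_scope.
Local Open Scope cat_scope.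

(** Let N_ij^k be the fusion coefficients, d_i the dimensions and i* the dual
    index.  The d_i are the values of a ring character d of the fusion ring,
    and positivity forces d_(i* ) = d_i.  Distinct characters chi and chi' are
    orthogonal: sum_i chi(i) chi'(i* ) = 0.  If both are invariant under
    duality, and if the simple objects other than the unit fall into pairs
    {i, i*}, this reads 1 + 2 sum_pairs chi(i) chi'(i) = 0, so that 1/2 would
    be an algebraic integer.  Hence d is the only character invariant under
    duality, it equals its Galois conjugates, and the d_i are rational; being
    eigenvalues of the integer matrices N_i, they are integers.

    The argument is carried out without Galois conjugates
    (fusion_dim_integral).  Let V be the space of the vectors v such that
    X_i v = X_(i* ) v for all i: it is cut out by integer equations, and it
    contains e = sum_i d_i X_(i* ).  If v lies in V and d(v) = 0, then
    0 = e v = v + 2 sum_pairs d_i X_i v; tensored with d, this becomes a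
    homogeneous system with integer matrix 1 + 2L, whose determinant is odd,
    and so v = 0 (fusion_symmetric_null).  Therefore V is the line spanned by
    e; a line defined over the rationals, on which the coordinate of the unit
    is 1 at e, has a rational generator e.

    Three facts are needed about the category.  Commutativity of the fusion
    rules is the braiding.  The symmetry N_ij^k = N_(k j* )^i is the adjunction
    between tensoring with X_j and with its dual, combined with the equality of
    the dimensions of Hom(X, Z) and Hom(Z, X) for X simple in a semisimple
    category.  The multiplicativity of dimensions (qdim_tensor) is proved with
    string diagrams.  A diagram is read as a family of morphisms, indexed by an
    object A standing to the right of all strands, between right-nested tensor
    products; whiskering a diagram on the right then amounts to changing A, and
    no associators remain between the strands of a computation.  The trace does
    not depend on the left dual used to close the loop (loop_cyclic), so the
    loop of X tensor Y may be closed with Y* tensor X*; the double braiding in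
    the twist of X tensor Y then turns it into two nested loops (loop_tensor).
 *)

(** * Integer linear systems *)

Section IntegralLinearAlgebra.
Variable F : numFieldType.

(** The matrix of the system is the identity modulo 2, so its determinant is odd. *)
Lemma odd_system_trivial (J : finType) (L : J -> J -> nat) (x : J -> F) :
  (forall j, x j + 2 * \sum_k (L j k)%:R * x k = 0) -> forall j, x j = 0.
Proof.
move=> sys.
pose A : 'M[int]_#|J| :=
  \matrix_(i, j) ((i == j)%:R + 2 * (L (enum_val i) (enum_val j))%:R).
have detA : (\det A)%:~R != 0 :> F.
  rewrite intr_eq0; apply/negP => /eqP detA0.
  have : \det (map_mx (intr : int -> 'F_2) A) = 0 by rewrite det_map_mx detA0.
  have -> : map_mx (intr : int -> 'F_2) A = 1%:M.
    apply/matrixP => i j; rewrite !mxE rmorphD rmorphM /=.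
    rewrite !rmorph_nat; have -> : (2%:R : 'F_2) = 0 by apply/eqP.
    by rewrite mul0r addr0.
  by rewrite det1 => /eqP; rewrite oner_eq0.
pose X : 'cV[F]_#|J| := \col_i x (enum_val i).
have AX : map_mx intr A *m X = 0.
  apply/colP => i; rewrite !mxE -[RHS](sys (enum_val i)).
  under eq_bigr => k _ do rewrite !mxE rmorphD rmorphM /= mulrDl.
  rewrite big_split /=; congr (_ + _).
    rewrite (bigD1 i) //= eqxx mul1r big1 ?addr0 // => k /negbTE ki.
    by rewrite eq_sym ki mul0r.
  rewrite mulr_sumr [RHS](reindex_onto enum_val enum_rank) => [|j _]; last first.
    by rewrite enum_rankK.
  rewrite [RHS](eq_bigl predT) => [|k]; last by rewrite enum_valK eqxx.
  by apply: eq_bigr => k _; rewrite mulrA !rmorph_nat.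
have X0 : X = 0.
  apply: (scalerI detA); rewrite scaler0 -mul_scalar_mx -det_map_mx -mul_adj_mx.
  by rewrite -mulmxA AX mulmx0.
by move=> j; have /colP/(_ (enum_rank j)) := X0; rewrite !mxE enum_rankK.
Qed.

(** Gaussian elimination over the rationals already finds a nonzero kernel
    vector; normalizing its coordinate at [o] gives [e]. *)
Lemma rational_kernel_line m p (A : 'M[rat]_(m, p)) (e : 'rV[F]_m) (o : 'I_m) :
  e *m map_mx ratr A = 0 -> e 0 o = 1 ->
  (forall v : 'rV[F]_m, v *m map_mx ratr A = 0 -> v = v 0 o *: e) ->
  exists q : 'rV[rat]_m, e = map_mx ratr q.
Proof.
move=> eA eo line.
have ker0 : nz_row (kermx A) != 0.
  rewrite nz_row_eq0; apply/eqP => ker0.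
  have : (e <= kermx (map_mx ratr A))%MS by apply/sub_kermxP.
  rewrite -map_kermx ker0 map_mx0 submx0 => /eqP e0.
  by move: eo; rewrite e0 mxE => /eqP; rewrite eq_sym oner_eq0.
set r := nz_row (kermx A) in ker0.
have rE : map_mx ratr r = ratr (r 0 o) *: e.
  have rA : r *m A = 0 by apply/sub_kermxP/nz_row_sub.
  by rewrite [LHS]line ?mxE // -map_mxM rA map_mx0.
have ro0 : ratr (r 0 o) != 0 :> F.
  apply: contraNneq ker0 => ro0; rewrite -(map_mx_eq0 (ratr : rat -> F)) rE.
  by rewrite ro0 scale0r.
exists ((r 0 o)^-1 *: r); rewrite map_mxZ rE scalerA fmorphV mulVf //.
by rewrite scale1r.
Qed.

(** A rational root of a monic integer polynomial is an integer; this is read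
    off from the algebraic integers of [algC]. *)
Lemma rational_eigenvalue_int n (M : 'M[int]_n) (q : rat) (v : 'rV[F]_n) :
  v != 0 -> v *m map_mx intr M = ratr q *: v -> exists m : int, q = m%:~R.
Proof.
move=> v0 vM; pose P : {poly rat} := map_poly intr (char_poly M).
have Pq : root P q.
  rewrite -(fmorph_root (ratr : {rmorphism rat -> F})).
  have -> : map_poly ratr P = char_poly (map_mx intr M) :> {poly F}.
    rewrite -map_char_poly /P -map_poly_comp; apply: eq_map_poly => z.
    by rewrite /= ratr_int.
  by rewrite -eigenvalue_root_char; apply/eigenvalueP; exists v.
have Aq : (ratr q : algC) \in Aint.
  apply: (@root_monic_Aint (map_poly intr (char_poly M))).
  - have -> : map_poly intr (char_poly M) = map_poly ratr P :> {poly algC}.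
      by rewrite /P -map_poly_comp; apply: eq_map_poly => z; rewrite /= ratr_int.
    by rewrite fmorph_root.
  - by rewrite monic_map // char_poly_monic.
  - by apply/polyOverP => i; rewrite coef_map /= rpred_int.
have /intrP [m qm] : (ratr q : algC) \is a Num.int.
  by apply: Cint_rat_Aint; rewrite ?Crat_rat.
exists m; apply: (fmorph_inj (ratr : {rmorphism rat -> algC})).
by rewrite /= qm ratr_int.
Qed.

End IntegralLinearAlgebra.

Lemma sum_involution (V : nmodType) n (s : 'I_n -> 'I_n) (o : 'I_n) (g : 'I_n -> V) :
  involutive s -> (forall i, s i = i <-> i = o) -> (forall i, g (s i) = g i) ->
  \sum_i g i = g o + (\sum_(i < n | (i < s i)%N) g i) *+ 2.
Proof.
move=> sK fix_s gs.
rewrite (bigD1 o) //= (bigID (fun i : 'I_n => (i < s i)%N)) /= mulr2n.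
congr (_ + (_ + _)).
  apply: eq_bigl => i; rewrite andb_idl // => lt_i; apply/eqP => io.
  by move: lt_i; rewrite (fix_s i).2 // ltnn.
rewrite (reindex_inj (inv_inj sK)) /=; apply: eq_big => [i|i _]; last exact: gs.
rewrite sK -leqNgt ltn_neqAle; congr (_ && _).
apply/idP/idP; apply: contraNneq.
  by move=> /val_inj E; rewrite (fix_s i).1 // (fix_s o).2.
by move=> E; rewrite -{1}(sK i) E (fix_s o).2.
Qed.

(** * Fusion rules with one self-dual element *)

Section FusionRules.
Variables (F : numFieldType) (n : nat) (N : 'I_n -> 'I_n -> 'I_n -> nat).
Variables (s : 'I_n -> 'I_n) (o : 'I_n) (d : 'I_n -> F).
Hypothesis N_unit : forall j k, N o j k = (j == k).
Hypothesis N_comm : forall i j k, N i j k = N j i k.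
Hypothesis N_dual : forall i j k, N i j k = N k (s j) i.
Hypothesis fix_s : forall i, s i = i <-> i = o.
Hypothesis d_mul : forall i j, d i * d j = \sum_k (N i j k)%:R * d k.
Hypothesis d_gt0 : forall i, 0 < d i.

(** The dual of j is the only index k such that the unit occurs in the product
    of j and k, a condition symmetric in j and k. *)
Lemma fusion_dualK : involutive s.
Proof.
move=> j; apply/eqP; have := N_comm (s j) j o.
by rewrite (N_dual (s j)) (N_dual j) !N_unit eqxx; case: eqP.
Qed.

Lemma fusion_dim_unit : d o = 1.
Proof.
apply: (mulfI (lt0r_neq0 (d_gt0 o))); rewrite mulr1 d_mul (bigD1 o) //=.
rewrite N_unit eqxx mul1r big1 ?addr0 // => k /negbTE ko.
by rewrite N_unit eq_sym ko mul0r.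
Qed.

Lemma fusion_cyclic i j k : N i (s j) k = N i (s k) j.
Proof. by rewrite -(N_dual k) (N_comm k) (N_dual j). Qed.

(** In the fusion ring: the product of X_i with e = sum_j d_j X_(j* ) is
    d_i e. *)
Lemma fusion_left_eigenvector i k :
  \sum_j d (s j) * (N i j k)%:R = d i * d (s k).
Proof.
rewrite d_mul (reindex_inj (inv_inj fusion_dualK)) /=.
by apply: eq_bigr => j _; rewrite fusion_dualK mulrC fusion_cyclic.
Qed.

(** The matrix of i* is the transpose of the matrix N_i.  Hence the positive row
    vector v with entries d_(k* ) satisfies v N_i = d_i v as well as
    v N_i^T = d_(i* ) v, and v N_i v^T is both d_i |v|^2 and d_(i* ) |v|^2. *)
Lemma fusion_dim_dual i : d (s i) = d i.
Proof.
have D_gt0 : 0 < \sum_k d (s k) * d (s k).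
  rewrite (bigD1 o) //=; apply: ltr_pwDl; first exact: mulr_gt0.
  by apply: sumr_ge0 => k _; rewrite mulr_ge0 // ltW.
apply: (mulIf (lt0r_neq0 D_gt0)); rewrite !mulr_sumr.
under eq_bigr => k _ do rewrite mulrA -fusion_left_eigenvector mulr_suml.
rewrite exchange_big; apply: eq_bigr => j _ /=.
rewrite mulrA -fusion_left_eigenvector mulr_suml; apply: eq_bigr => k _.
by rewrite mulrC mulrCA mulrC (N_comm i) (N_dual k) (N_comm _ (s i)) mulrAC.
Qed.

(** With e = sum_i d_i X_(i* ), commutativity gives e v = d(v) e = 0.  On the
    other hand v is symmetric, so that e v = v + 2 sum_(i < i* ) d_i X_i v.
    The coefficients d_i are not integers; but multiplying by d_l and expanding
    d_l d_i through the fusion rules gives an integer system for the products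
    d_l v_k. *)
Lemma fusion_symmetric_null (v : 'I_n -> F) :
  (forall i k, \sum_j v j * (N i j k)%:R = \sum_j v j * (N (s i) j k)%:R) ->
  \sum_j v j * d j = 0 -> forall k, v k = 0.
Proof.
move=> vsym vd; pose w i k := \sum_j v j * (N i j k)%:R.
(* w i is the product of X_i and v *)
have wo k : w o k = v k.
  rewrite /w (bigD1 k) //= N_unit eqxx mulr1 big1 ?addr0 // => j /negbTE jk.
  by rewrite N_unit jk mulr0.
have w0 k : \sum_i d i * w i k = 0.
  transitivity (\sum_i \sum_j v j * (d i * (N j (s k) i)%:R)).
    apply: eq_bigr => i _; rewrite /w vsym mulr_sumr; apply: eq_bigr => j _.
    by rewrite mulrCA (N_comm (s i)) fusion_cyclic.
  transitivity ((\sum_j v j * d j) * d (s k)); last by rewrite vd mul0r.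
  rewrite exchange_big /= mulr_suml.
  apply: eq_bigr => j _; rewrite -mulr_sumr -mulrA d_mul; congr (_ * _).
  by apply: eq_bigr => i _; rewrite mulrC.
(* the unknowns of the integer system are the d l * v k *)
pose L (a b : 'I_n * 'I_n) :=
  (\sum_(i < n | (i < s i)%N) N a.1 i b.1 * N i b.2 a.2)%N.
have sys (a : 'I_n * 'I_n) :
    d a.1 * v a.2 + 2 * \sum_b (L a b)%:R * (d b.1 * v b.2) = 0.
  case: a => l k /=.
  have -> : \sum_b (L (l, k) b)%:R * (d b.1 * v b.2)
      = \sum_(i < n | (i < s i)%N) d l * (d i * w i k).
    under eq_bigr => b _ do rewrite /L natr_sum mulr_suml.
    rewrite exchange_big; apply: eq_bigr => i _ /=; rewrite mulrA d_mul /w.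
    rewrite big_distrlr /= pair_bigA /=; apply: eq_bigr => -[m j] _ /=.
    by rewrite natrM; ring.
  have := w0 k; rewrite (sum_involution fusion_dualK fix_s) => [w0k|i].
    rewrite -mulr_sumr mulrCA -mulrDr; apply/eqP; rewrite mulf_eq0; apply/orP.
    by right; rewrite mulr_natl -[v k]wo -[w o k]mul1r -fusion_dim_unit w0k.
  by rewrite fusion_dim_dual /w -vsym.
move=> k; have := odd_system_trivial sys (o, k).
by rewrite /= fusion_dim_unit mul1r.
Qed.

Theorem fusion_dim_integral a : exists m : int, d a = m%:~R.
Proof.
(* the row kernel of A consists of the v such that X_i v = X_(i* ) v for all i *)
pose A : 'M[rat]_(n, n * n) :=
  \matrix_(j < n) mxvec (\matrix_(i < n, k < n) ((N i j k)%:R - (N (s i) j k)%:R)).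
have AP (v : 'rV[F]_n) : v *m map_mx ratr A = 0 <->
    forall i k, \sum_j v 0 j * (N i j k)%:R = \sum_j v 0 j * (N (s i) j k)%:R.
  have vAE i k : (v *m map_mx ratr A) 0 (mxvec_index i k)
      = \sum_j v 0 j * (N i j k)%:R - \sum_j v 0 j * (N (s i) j k)%:R.
    rewrite !mxE -sumrB; apply: eq_bigr => j _.
    by rewrite !mxE mxvecE mxE rmorphB /= !ratr_nat mulrBr.
  split=> [vA i k|vsym].
    by apply/eqP; rewrite -subr_eq0 -vAE vA mxE.
  apply/rowP => p; case/mxvec_indexP: p => i k.
  by rewrite vAE vsym subrr mxE.
pose e : 'rV[F]_n := \row_j d j.
have eN i k : \sum_j e 0 j * (N i j k)%:R = d i * d k.
  rewrite -(fusion_dim_dual k) -fusion_left_eigenvector.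
  by apply: eq_bigr => j _; rewrite mxE fusion_dim_dual.
have eA : e *m map_mx ratr A = 0.
  by apply/AP => i k; rewrite !eN fusion_dim_dual.
have eo : e 0 o = 1 by rewrite mxE fusion_dim_unit.
have D_gt0 : 0 < \sum_k d k * d k.
  rewrite (bigD1 o) //=; apply: ltr_pwDl; first exact: mulr_gt0.
  by apply: sumr_ge0 => k _; rewrite mulr_ge0 // ltW.
have line (v : 'rV[F]_n) : v *m map_mx ratr A = 0 -> v = v 0 o *: e.
  move=> vA; pose c := (\sum_k v 0 k * d k) / \sum_k d k * d k.
  have veE : v - c *: e = 0.
    apply/rowP => k; rewrite [RHS]mxE.
    apply: (@fusion_symmetric_null (fun k => (v - c *: e) 0 k)).
      by apply/AP; rewrite mulmxBl -scalemxAl vA eA scaler0 subrr.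
    under eq_bigr => j _ do rewrite !mxE mulrBl -mulrA.
    by rewrite sumrB -mulr_sumr divfK ?subrr // lt0r_neq0.
  move/eqP: veE; rewrite subr_eq0 => /eqP ->.
  by rewrite !mxE fusion_dim_unit mulr1.
have [q eq] := rational_kernel_line eA eo line.
have dq j : d j = ratr (q 0 j) by have /rowP/(_ j) := eq; rewrite !mxE.
have [||m qm] := @rational_eigenvalue_int F n (\matrix_(j, k) (N a j k)%:R) (q 0 a) e.
- by apply: contraTneq (oner_neq0 F) => e0; rewrite -eo e0 mxE eqxx.
- apply/rowP => k; rewrite mxE [RHS]mxE -dq [in RHS]mxE -eN.
  by apply: eq_bigr => j _; rewrite !mxE rmorph_nat.
by exists m; rewrite dq qm ratr_int.
Qed.

End FusionRules.

(** * Whiskering and coherence *)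

Notation "X ◁ f" := (idm X ⊠ f) (at level 40, left associativity) : cat_scope.
Notation "f ▷ X" := (f ⊠ idm X) (at level 40, left associativity) : cat_scope.

Section LinearCategory.
Variables (K : fieldType) (C : linearCategory K).
Implicit Types X Y Z W : C.

(** Composites are kept associated to the right; [comp_pre] and [comp_pre3]
    turn an equation between composites into a rewriting rule for the head of a
    longer composite. *)
Lemma comp_pre X Y Z (g : hom Y Z) (f : hom X Y) (h : hom X Z) :
  g \oc f = h -> forall W (k : hom W X), g \oc f \oc k = h \oc k.
Proof. by move=> <- W k; rewrite compA. Qed.

Lemma comp_pre3 W X Y Z (h : hom Y Z) (g : hom X Y) (f : hom W X) k :
  h \oc g \oc f = k ->
  forall V (l : hom V W), h \oc g \oc f \oc l = k \oc l.
Proof. by move=> <- V l; rewrite !compA. Qed.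

Lemma is_iso_mutual_inverse X Y (f : hom X Y) (g : hom Y X) :
  mutual_inverse f g -> is_iso f.
Proof. by exists g. Qed.

Lemma compIf X Y Z (f : hom X Y) (g g' : hom Y Z) :
  is_iso f -> g \oc f = g' \oc f -> g = g'.
Proof.
by case=> h [_ fh] E; rewrite -[g]compm1 -[g']compm1 -fh !compA E.
Qed.

Lemma compfI X Y Z (f : hom Y Z) (g g' : hom X Y) :
  is_iso f -> f \oc g = f \oc g' -> g = g'.
Proof.
by case=> h [hf _] E; rewrite -[g]comp1m -[g']comp1m -hf -!compA E.
Qed.

End LinearCategory.

Section MonoidalCategory.
Variables (K : fieldType) (C : monoidalCategory K).
Implicit Types X Y Z W A B : C.

Lemma whiskerl_comp X Y Y' Y'' (g : hom Y' Y'') (f : hom Y Y') :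
  X ◁ (g \oc f) = (X ◁ g) \oc (X ◁ f).
Proof. by rewrite -tensorm_comp comp1m. Qed.

Lemma whiskerr_comp X Y Y' Y'' (g : hom Y' Y'') (f : hom Y Y') :
  (g \oc f) ▷ X = (g ▷ X) \oc (f ▷ X).
Proof. by rewrite -tensorm_comp comp1m. Qed.

Lemma whiskerl_cancel X Y Z (g : hom Y Z) (f : hom Z Y) :
  g \oc f = idm Z -> (X ◁ g) \oc (X ◁ f) = idm (X ⊗ Z).
Proof. by move=> E; rewrite -whiskerl_comp E tensorm1. Qed.

Lemma whiskerr_cancel X Y Z (g : hom Y Z) (f : hom Z Y) :
  g \oc f = idm Z -> (g ▷ X) \oc (f ▷ X) = idm (Z ⊗ X).
Proof. by move=> E; rewrite -whiskerr_comp E tensorm1. Qed.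

Lemma whisker_exchange X X' Y Y' (f : hom X X') (g : hom Y Y') :
  (f ▷ Y') \oc (X ◁ g) = (X' ◁ g) \oc (f ▷ Y).
Proof. by rewrite -!tensorm_comp !comp1m !compm1. Qed.

Lemma tensorm_whisker X X' Y Y' (f : hom X X') (g : hom Y Y') :
  f ⊠ g = (f ▷ Y') \oc (X ◁ g).
Proof. by rewrite -!tensorm_comp !comp1m !compm1. Qed.

Lemma assocVK X Y Z : assoc_inv X Y Z \oc assoc X Y Z = idm (X ⊗ Y ⊗ Z).
Proof. by case: (assocK X Y Z). Qed.
Lemma assocKV X Y Z : assoc X Y Z \oc assoc_inv X Y Z = idm (X ⊗ (Y ⊗ Z)).
Proof. by case: (assocK X Y Z). Qed.
Lemma unitlVK X : unitl_inv X \oc unitl X = idm (𝟙 ⊗ X).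
Proof. by case: (unitlK X). Qed.
Lemma unitlKV X : unitl X \oc unitl_inv X = idm X.
Proof. by case: (unitlK X). Qed.
Lemma unitrKV X : unitr X \oc unitr_inv X = idm X.
Proof. by case: (unitrK X). Qed.

Lemma assoc_inv_natural X X' Y Y' Z Z'
    (f : hom X X') (g : hom Y Y') (h : hom Z Z') :
  assoc_inv X' Y' Z' \oc (f ⊠ (g ⊠ h)) = ((f ⊠ g) ⊠ h) \oc assoc_inv X Y Z.
Proof.
rewrite -[f ⊠ (g ⊠ h)]compm1 -(assocKV X Y Z) (compA (f ⊠ _)) -assoc_natural.
by rewrite !compA assocVK comp1m.
Qed.

Lemma unitl_inv_natural X Y (f : hom X Y) :
  unitl_inv Y \oc f = (𝟙 ◁ f) \oc unitl_inv X.
Proof.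
by rewrite -[f in LHS]compm1 -(unitlKV X) (compA f) -unitl_natural !compA unitlVK
           comp1m.
Qed.

Lemma triangle_inv X Y :
  assoc X 𝟙 Y \oc (unitr_inv X ▷ Y) = X ◁ unitl_inv Y.
Proof.
apply: (@compfI _ _ _ _ _ (X ◁ unitl Y)).
  exists (X ◁ unitl_inv Y).
  by split; rewrite -whiskerl_comp ?unitlVK ?unitlKV tensorm1.
by rewrite compA triangle -whiskerr_comp -whiskerl_comp unitrKV unitlKV !tensorm1.
Qed.

Lemma triangle_assoc_inv X Y :
  (unitr X ▷ Y) \oc assoc_inv X 𝟙 Y = X ◁ unitl Y.
Proof. by rewrite -triangle -compA assocKV compm1. Qed.

Lemma pentagon_inv W X Y Z :
  (W ◁ assoc_inv X Y Z) \oc assoc W X (Y ⊗ Z)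
  = assoc W (X ⊗ Y) Z \oc (assoc W X Y ▷ Z) \oc assoc_inv (W ⊗ X) Y Z.
Proof.
rewrite -[assoc W X (Y ⊗ Z) in LHS]compm1 -(assocKV (W ⊗ X) Y Z).
rewrite (compA (assoc _ _ _)) pentagon !compA -whiskerl_comp assocVK.
by rewrite tensorm1 comp1m.
Qed.

Lemma pentagon_inv_whiskerl W X Y Z :
  assoc_inv W X (Y ⊗ Z) \oc (W ◁ assoc X Y Z)
  = assoc (W ⊗ X) Y Z \oc (assoc_inv W X Y ▷ Z) \oc assoc_inv W (X ⊗ Y) Z.
Proof.
rewrite -[W ◁ _ in LHS]compm1 -(assocKV W (X ⊗ Y) Z).
rewrite -[assoc W (X ⊗ Y) Z in LHS]compm1 -tensorm1 -(assocKV W X Y).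
rewrite whiskerr_comp -!compA (comp_pre3 (esym (pentagon _ _ _ _))) -!compA.
by rewrite (comp_pre (assocVK _ _ _)) comp1m.
Qed.

Lemma assoc_inv_unitl_inv X Y :
  assoc_inv X 𝟙 Y \oc (X ◁ unitl_inv Y) = unitr_inv X ▷ Y.
Proof. by rewrite -triangle_inv compA assocVK comp1m. Qed.

Lemma whiskerl1I X Y (f g : hom X Y) : (𝟙 : C) ◁ f = 𝟙 ◁ g -> f = g.
Proof.
move=> E; apply: (@compIf _ _ _ _ _ (unitl X)).
  exact: (is_iso_mutual_inverse (unitlK X)).
by rewrite -!unitl_natural E.
Qed.

Lemma whiskerr1I X Y (f g : hom X Y) : f ▷ (𝟙 : C) = g ▷ 𝟙 -> f = g.
Proof.
move=> E; apply: (@compIf _ _ _ _ _ (unitr X)).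
  exact: (is_iso_mutual_inverse (unitrK X)).
by rewrite -!unitr_natural E.
Qed.

Lemma assoc_iso X Y Z : is_iso (assoc X Y Z).
Proof. exact: (is_iso_mutual_inverse (assocK X Y Z)). Qed.

Lemma whiskerr_iso X Y Z (f : hom X Y) : is_iso f -> is_iso (f ▷ Z).
Proof.
case=> g [gf fg]; exists (g ▷ Z).
by split; rewrite -whiskerr_comp ?gf ?fg tensorm1.
Qed.

Lemma whiskerl_iso X Y Z (f : hom X Y) : is_iso f -> is_iso (Z ◁ f).
Proof.
case=> g [gf fg]; exists (Z ◁ g).
by split; rewrite -whiskerl_comp ?gf ?fg tensorm1.
Qed.

(** Kelly's consequence of the pentagon and the triangle: after whiskering by
    the unit, the two sides differ by the pentagon for unit, unit, X, Y. *)
Lemma unitl_tensor X Y : unitl (X ⊗ Y) \oc assoc 𝟙 X Y = unitl X ▷ Y.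
Proof.
apply: whiskerl1I; rewrite whiskerl_comp.
apply: (compIf (assoc_iso 𝟙 (𝟙 ⊗ X) Y)).
apply: (compIf (whiskerr_iso Y (assoc_iso 𝟙 𝟙 X))).
rewrite -!compA -pentagon compA triangle -tensorm1 -assoc_natural.
by rewrite [RHS]compA -assoc_natural -compA -whiskerr_comp triangle.
Qed.

Lemma unitl_inv_tensor X Y :
  assoc_inv 𝟙 X Y \oc unitl_inv (X ⊗ Y) = unitl_inv X ▷ Y.
Proof.
apply: (@compfI _ _ _ _ _ (unitl X ▷ Y)).
  by apply: whiskerr_iso; apply: (is_iso_mutual_inverse (unitlK X)).
rewrite -whiskerr_comp unitlKV tensorm1 -unitl_tensor -!compA.
by rewrite (comp_pre (assocKV _ _ _)) comp1m unitlKV.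
Qed.

Lemma unitl1 : unitl (𝟙 : C) = unitr 𝟙.
Proof.
apply: whiskerr1I; rewrite -unitl_tensor -triangle; congr (_ \oc _).
apply: (@compfI _ _ _ _ _ (unitl 𝟙)).
  exact: (is_iso_mutual_inverse (unitlK 𝟙)).
by rewrite unitl_natural.
Qed.

End MonoidalCategory.

(** * Strands: caps, cups and boxes *)

(** [cap], [cup] and [box] are locked because unification would otherwise see
    the composites inside them when rewriting with associativity. *)
HB.lock Definition cap (K : fieldType) (C : monoidalCategory K) (X Y : C)
  (e : hom (X ⊗ Y) 𝟙) (A : C) : hom (X ⊗ (Y ⊗ A)) A :=
  unitl A \oc (e ▷ A) \oc assoc_inv X Y A.

HB.lock Definition cup (K : fieldType) (C : monoidalCategory K) (X Y : C)
  (c : hom 𝟙 (X ⊗ Y)) (A : C) : hom A (X ⊗ (Y ⊗ A)) :=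
  assoc X Y A \oc (c ▷ A) \oc unitl_inv A.

HB.lock Definition box (K : fieldType) (C : monoidalCategory K)
  (X Y X' Y' : C) (b : hom (X ⊗ Y) (X' ⊗ Y')) (A : C) :
  hom (X ⊗ (Y ⊗ A)) (X' ⊗ (Y' ⊗ A)) :=
  assoc X' Y' A \oc (b ▷ A) \oc assoc_inv X Y A.

Section Strands.
Variables (K : fieldType) (C : monoidalCategory K).
Implicit Types X Y Z W A B : C.

Lemma capE X Y (e : hom (X ⊗ Y) 𝟙) A :
  cap e A = unitl A \oc (e ▷ A) \oc assoc_inv X Y A.
Proof. by rewrite unlock. Qed.

Lemma cupE X Y (c : hom 𝟙 (X ⊗ Y)) A :
  cup c A = assoc X Y A \oc (c ▷ A) \oc unitl_inv A.
Proof. by rewrite unlock. Qed.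

Lemma boxE X Y X' Y' (b : hom (X ⊗ Y) (X' ⊗ Y')) A :
  box b A = assoc X' Y' A \oc (b ▷ A) \oc assoc_inv X Y A.
Proof. by rewrite unlock. Qed.

Lemma cap_natural X Y (e : hom (X ⊗ Y) 𝟙) A B (f : hom A B) :
  cap e B \oc (X ◁ (Y ◁ f)) = f \oc cap e A.
Proof.
rewrite !capE -!compA assoc_inv_natural tensorm1.
by rewrite (comp_pre (whisker_exchange _ _)) !compA unitl_natural.
Qed.

Lemma cup_natural X Y (c : hom 𝟙 (X ⊗ Y)) A B (f : hom A B) :
  cup c B \oc f = (X ◁ (Y ◁ f)) \oc cup c A.
Proof.
rewrite !cupE -!compA unitl_inv_natural (comp_pre (whisker_exchange _ _)).
by rewrite -tensorm1 !compA assoc_natural.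
Qed.

Lemma box_natural X Y X' Y' (b : hom (X ⊗ Y) (X' ⊗ Y')) A B (f : hom A B) :
  box b B \oc (X ◁ (Y ◁ f)) = (X' ◁ (Y' ◁ f)) \oc box b A.
Proof.
rewrite !boxE -!compA assoc_inv_natural tensorm1.
rewrite (comp_pre (whisker_exchange _ _)) -tensorm1.
by rewrite !compA assoc_natural.
Qed.

Lemma cap_box X Y X' Y' (e : hom (X' ⊗ Y') 𝟙) (b : hom (X ⊗ Y) (X' ⊗ Y')) A :
  cap e A \oc box b A = cap (e \oc b) A.
Proof.
by rewrite !capE boxE -!compA (comp_pre (assocVK _ _ _)) comp1m whiskerr_comp !compA.
Qed.

Lemma box_cup X Y X' Y' (c : hom 𝟙 (X ⊗ Y)) (b : hom (X ⊗ Y) (X' ⊗ Y')) A :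
  box b A \oc cup c A = cup (b \oc c) A.
Proof.
by rewrite !cupE boxE -!compA (comp_pre (assocVK _ _ _)) comp1m whiskerr_comp !compA.
Qed.

Lemma box_comp X Y X' Y' X'' Y'' (b' : hom (X' ⊗ Y') (X'' ⊗ Y''))
    (b : hom (X ⊗ Y) (X' ⊗ Y')) A :
  box (b' \oc b) A = box b' A \oc box b A.
Proof.
by rewrite !boxE -!compA (comp_pre (assocVK _ _ _)) comp1m whiskerr_comp !compA.
Qed.

Lemma box_whiskerr X X' Y (f : hom X X') A : box (f ▷ Y) A = f ▷ (Y ⊗ A).
Proof. by rewrite !boxE compA assoc_natural -compA assocKV compm1 tensorm1. Qed.

Lemma box_whiskerl X Y Y' (f : hom Y Y') A : box (X ◁ f) A = X ◁ (f ▷ A).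
Proof. by rewrite !boxE compA assoc_natural -compA assocKV compm1. Qed.

Lemma cap_cup X Y (e : hom (X ⊗ Y) 𝟙) (c : hom 𝟙 (X ⊗ Y)) A :
  cap e A \oc cup c A = unitl A \oc ((e \oc c) ▷ A) \oc unitl_inv A.
Proof.
by rewrite capE cupE -!compA (comp_pre (assocVK _ _ _)) comp1m whiskerr_comp !compA.
Qed.

(** Families built from morphisms commute with tensoring on the right; this is
    what naturality in A alone would not give. *)
Lemma cap_tensor X Y (e : hom (X ⊗ Y) 𝟙) A B :
  cap e A ▷ B
  = cap e (A ⊗ B) \oc (X ◁ assoc Y A B) \oc assoc X (Y ⊗ A) B.
Proof.
rewrite !capE !whiskerr_comp -unitl_tensor -!compA; congr (_ \oc _).
rewrite compA assoc_natural tensorm1 -!compA; congr (_ \oc _).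
apply: (compIf (whiskerr_iso B (assoc_iso X Y A))).
rewrite -!compA -(pentagon X Y A B) -whiskerr_comp assocVK tensorm1 compm1.
by rewrite compA assocVK comp1m.
Qed.

Lemma cup_tensor X Y (c : hom 𝟙 (X ⊗ Y)) A B :
  (X ◁ assoc Y A B) \oc assoc X (Y ⊗ A) B \oc (cup c A ▷ B)
  = cup c (A ⊗ B).
Proof.
rewrite !cupE !whiskerr_comp (comp_pre3 (esym (pentagon _ _ _ _))).
rewrite -!compA (comp_pre (assoc_natural _ _ _)) tensorm1 -!compA.
by rewrite -unitl_inv_tensor (comp_pre (assocKV _ _ _)) comp1m.
Qed.

(** The two triangle identities of a left dual, in the presence of further
    strands A on the right. *)
Definition zigzagl X D (e : hom (D ⊗ X) 𝟙) (c : hom 𝟙 (X ⊗ D)) : Prop :=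
  forall A, (X ◁ cap e A) \oc cup c (X ⊗ A) = idm (X ⊗ A).

Definition zigzagr X D (e : hom (D ⊗ X) 𝟙) (c : hom 𝟙 (X ⊗ D)) : Prop :=
  forall A, cap e (D ⊗ A) \oc (D ◁ cup c A) = idm (D ⊗ A).

Lemma left_dual_zigzagl X D (e : hom (D ⊗ X) 𝟙) (c : hom 𝟙 (X ⊗ D)) :
  is_left_dual e c -> zigzagl e c.
Proof.
case=> E _ A; rewrite -[RHS]tensorm1; move/(congr1 (fun f => f ▷ A)): E => <-.
rewrite !whiskerr_comp capE cupE.
rewrite !whiskerl_comp -!compA (comp_pre (pentagon_inv _ _ _ _)) -!compA.
rewrite -(triangle X A) -!compA (comp_pre (assoc_natural _ _ _)) -!compA.
rewrite -unitl_inv_tensor (comp_pre (esym (assoc_inv_natural _ _ _))).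
by rewrite tensorm1 -!compA.
Qed.

Lemma left_dual_zigzagr X D (e : hom (D ⊗ X) 𝟙) (c : hom 𝟙 (X ⊗ D)) :
  is_left_dual e c -> zigzagr e c.
Proof.
case=> _ E A; rewrite -[RHS]tensorm1; move/(congr1 (fun f => f ▷ A)): E => <-.
rewrite !whiskerr_comp capE cupE.
rewrite !whiskerl_comp -!compA.
rewrite (comp_pre (pentagon_inv_whiskerl _ _ _ _)) -!compA.
rewrite (comp_pre (assoc_inv_natural _ _ _)) -assoc_inv_unitl_inv.
rewrite -[in LHS]tensorm1 (comp_pre (esym (assoc_natural _ _ _))).
by rewrite -unitl_tensor -!compA.
Qed.

(** The mate of f : X -> Y is its dual DY -> DX, for arbitrary choices of DX and
    DY.  It is a morphism, and not only a family indexed by A, so that the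
    naturality of the braiding applies to it. *)
Section Mate.
Variables (X DX Y DY : C).
Variables (eX : hom (DX ⊗ X) 𝟙) (cX : hom 𝟙 (X ⊗ DX)).
Variables (eY : hom (DY ⊗ Y) 𝟙) (cY : hom 𝟙 (Y ⊗ DY)).
Variable f : hom X Y.

Definition mate : hom DY DX :=
  cap eY DX \oc (DY ◁ ((f ▷ DX) \oc cX)) \oc unitr_inv DY.

Lemma mate_whiskerr A :
  mate ▷ A
  = cap eY (DX ⊗ A) \oc (DY ◁ ((f ▷ (DX ⊗ A)) \oc cup cX A)).
Proof.
rewrite /mate !whiskerr_comp cap_tensor -!compA; congr (_ \oc _).
rewrite (comp_pre (assoc_natural _ _ _)) -!compA triangle_inv -!whiskerl_comp.
by rewrite -(box_whiskerr _ f) box_cup cupE whiskerr_comp !compA.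
Qed.

(** Sliding f around the cap uses one triangle identity for X only, and sliding
    it around the cup one for Y only; [zigzagl] is thus all that the invariance
    of the trace will ask of a dual. *)
Lemma cap_mate A :
  zigzagl eX cX -> cap eX A \oc (mate ▷ (X ⊗ A)) = cap eY A \oc (DY ◁ (f ▷ A)).
Proof.
move=> zX; rewrite mate_whiskerr compA -cap_natural -compA -!whiskerl_comp.
by rewrite compA -whisker_exchange -compA zX compm1.
Qed.

Lemma cup_mate A :
  zigzagl eY cY -> (Y ◁ (mate ▷ A)) \oc cup cY A = (f ▷ (DX ⊗ A)) \oc cup cX A.
Proof.
move=> zY; rewrite mate_whiskerr whiskerl_comp -compA -cup_natural compA zY.
by rewrite comp1m.
Qed.

End Mate.

(** The dual of a tensor product, with nested caps and cups. *)
Section TensorDual.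
Variables (X X' Y Y' : C).
Variables (eX : hom (X' ⊗ X) 𝟙) (cX : hom 𝟙 (X ⊗ X')).
Variables (eY : hom (Y' ⊗ Y) 𝟙) (cY : hom 𝟙 (Y ⊗ Y')).

Definition tensor_ev : hom ((Y' ⊗ X') ⊗ (X ⊗ Y)) 𝟙 :=
  eY \oc (Y' ◁ cap eX Y) \oc assoc Y' X' (X ⊗ Y).

Definition tensor_coev : hom 𝟙 ((X ⊗ Y) ⊗ (Y' ⊗ X')) :=
  assoc_inv X Y (Y' ⊗ X') \oc (X ◁ cup cY X') \oc cX.

Lemma cap_tensor_ev A :
  cap tensor_ev A
  = cap eY A \oc (Y' ◁ (cap eX (Y ⊗ A) \oc (X' ◁ assoc X Y A)))
      \oc assoc Y' X' (X ⊗ Y ⊗ A).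
Proof.
rewrite /tensor_ev (capE _ A) (capE eY) !whiskerr_comp -!compA; congr (_ \oc _).
congr (_ \oc _); apply: (compfI (assoc_iso Y' Y A)).
rewrite (comp_pre (assocKV _ _ _)) comp1m (comp_pre (assoc_natural _ _ _)).
rewrite cap_tensor !whiskerl_comp -!compA (comp_pre3 (esym (pentagon _ _ _ _))).
by rewrite -!compA assocKV compm1.
Qed.

Lemma cup_tensor_coev A :
  cup tensor_coev A
  = assoc_inv X Y (Y' ⊗ X' ⊗ A)
      \oc (X ◁ ((Y ◁ assoc_inv Y' X' A) \oc cup cY (X' ⊗ A))) \oc cup cX A.
Proof.
apply: (compfI (assoc_iso X Y _)); rewrite (comp_pre (assocKV _ _ _)) comp1m.
rewrite /tensor_coev [cup _ A in LHS]cupE [cup cX A]cupE.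
rewrite !whiskerr_comp !compA; congr (_ \oc _).
congr (_ \oc _); rewrite -!compA -cup_tensor [Y ◁ _ \oc _]compA.
rewrite -whiskerl_comp assocVK tensorm1 comp1m whiskerl_comp -compA.
rewrite -assoc_natural (comp_pre (pentagon _ _ _ _)) -!compA.
by rewrite (comp_pre (whiskerr_cancel _ (assocKV _ _ _))) comp1m.
Qed.

Lemma tensor_zigzagl :
  zigzagl eX cX -> zigzagl eY cY -> zigzagl tensor_ev tensor_coev.
Proof.
move=> zX zY A; rewrite cap_tensor_ev cup_tensor_coev.
have natE V W (g : hom V W) : (X ⊗ Y ◁ g) \oc assoc_inv X Y V
    = assoc_inv X Y W \oc (X ◁ (Y ◁ g)) by rewrite assoc_inv_natural tensorm1.
rewrite (comp_pre (natE _ _ _)) -!compA (comp_pre (esym (whiskerl_comp _ _ _))).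
rewrite compA (comp_pre (esym (whiskerl_comp _ _ _))) -!compA assocKV compm1.
rewrite [Y ◁ _]whiskerl_comp -compA -cup_natural (comp_pre (zY _)) comp1m.
rewrite whiskerl_comp -compA -cup_natural (comp_pre (zX _)) comp1m.
exact: assocVK.
Qed.

End TensorDual.
End Strands.

(** * Crossings *)

Section Braid.
Variables (K : fieldType) (C : ribbonCategory K).
Implicit Types X Y Z W A B : C.

Definition cross X Y A : hom (X ⊗ (Y ⊗ A)) (Y ⊗ (X ⊗ A)) := box (braid X Y) A.

Lemma cross_natural X Y A B (f : hom A B) :
  cross X Y B \oc (X ◁ (Y ◁ f)) = (Y ◁ (X ◁ f)) \oc cross X Y A.
Proof. exact: box_natural. Qed.

Lemma cross_whiskerr X X' Y (f : hom X X') A :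
  cross X' Y A \oc (f ▷ (Y ⊗ A)) = (Y ◁ (f ▷ A)) \oc cross X Y A.
Proof.
by rewrite /cross -(box_whiskerr _ f) -(box_whiskerl _ f) -!box_comp braid_natural.
Qed.

Lemma cross_whiskerl X Y Y' (f : hom Y Y') A :
  cross X Y' A \oc (X ◁ (f ▷ A)) = (f ▷ (X ⊗ A)) \oc cross X Y A.
Proof.
by rewrite /cross -(box_whiskerr _ f) -(box_whiskerl _ f) -!box_comp braid_natural.
Qed.

(** The first hexagon: a strand crosses Y tensor Z by crossing Y, then Z. *)
Lemma cross_tensorl X Y Z A :
  cross X (Y ⊗ Z) A
  = assoc_inv Y Z (X ⊗ A) \oc (Y ◁ cross X Z A) \oc cross X Y (Z ⊗ A)
      \oc (X ◁ assoc Y Z A).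
Proof.
apply: (compfI (assoc_iso Y Z (X ⊗ A))); rewrite (comp_pre (assocKV _ _ _)) comp1m.
have := congr1 (fun f => f ▷ A) (hexagonl X Y Z); rewrite !whiskerr_comp => hex.
rewrite /cross !boxE !whiskerl_comp -!compA pentagon_inv_whiskerl.
rewrite -[braid X Y ▷ (Z ⊗ A)]box_whiskerr boxE -!compA.
rewrite (comp_pre (assocVK _ _ _)) comp1m (comp_pre (pentagon_inv _ _ _ _)) -!compA.
rewrite (comp_pre (assocVK _ _ _)) comp1m (comp_pre (esym (assoc_natural _ _ _))).
rewrite -!compA (comp_pre3 (esym hex)) -!compA.
rewrite (comp_pre (pentagon _ _ _ _)) -!compA.
by rewrite (comp_pre (whiskerr_cancel _ (assocKV _ _ _))) comp1m.
Qed.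

Lemma cross_tensorr X Y Z A :
  cross (X ⊗ Y) Z A
  = (Z ◁ assoc_inv X Y A) \oc cross X Z (Y ⊗ A) \oc (X ◁ cross Y Z A)
      \oc assoc X Y (Z ⊗ A).
Proof.
have := congr1 (fun f => f ▷ A) (hexagonr X Y Z); rewrite !whiskerr_comp => hex.
rewrite /cross !boxE !whiskerl_comp -!compA pentagon_inv.
rewrite (comp_pre (esym (assoc_natural _ _ _))) -!compA.
rewrite (comp_pre (pentagon_inv_whiskerl _ _ _ _)) -!compA.
rewrite (comp_pre (assocVK _ _ _)) comp1m.
rewrite -[braid X Z ▷ (Y ⊗ A)]box_whiskerr boxE -!compA.
rewrite (comp_pre (assocVK _ _ _)) comp1m (comp_pre3 (esym hex)) -!compA.
rewrite (comp_pre (pentagon _ _ _ _)) -!compA.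
rewrite (comp_pre (whiskerl_cancel _ (assocVK _ _ _))) comp1m.
rewrite (comp_pre (whiskerr_cancel _ (assocKV _ _ _))) comp1m.
by rewrite (comp_pre (whiskerr_cancel _ (assocVK _ _ _))) comp1m.
Qed.

(** By the hexagon for X and two units, the automorphism of X that measures the
    difference between the two sides is idempotent, hence the identity. *)
Lemma unitl_braid X : unitl X \oc braid X 𝟙 = unitr X.
Proof.
have braidK : is_iso (unitl X \oc braid X 𝟙).
  have [b [bK Kb]] := braid_iso X 𝟙; exists (b \oc unitl_inv X); split.
    by rewrite -!compA (comp_pre (unitlVK _)) comp1m.
  by rewrite -!compA (comp_pre Kb) comp1m unitlKV.
apply: whiskerr1I; apply: (compfI braidK).
have := congr1 (fun f => unitl X \oc (𝟙 ◁ unitl X) \oc f) (hexagonl X 𝟙 𝟙).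
rewrite -!compA (comp_pre (triangle _ _)) -unitl1.
rewrite (comp_pre (esym (braid_natural _ _))) -!compA triangle.
move=> ->; rewrite (comp_pre (esym (whiskerl_comp _ _ _))) (comp_pre (unitl_natural _)).
by rewrite -!compA (comp_pre (unitl_tensor _ _)) -whiskerr_comp.
Qed.

Lemma unitl_cross X A : unitl (X ⊗ A) \oc cross X 𝟙 A = X ◁ unitl A.
Proof.
rewrite /cross boxE (comp_pre (unitl_tensor _ _)) (comp_pre (esym (whiskerr_comp _ _ _))).
by rewrite unitl_braid triangle_assoc_inv.
Qed.

(** A strand that crosses both legs of a cap can be pulled off the cap. *)
Lemma cap_cross X Y Z (e : hom (Y ⊗ Z) 𝟙) A :
  cap e (X ⊗ A) \oc (Y ◁ cross X Z A) \oc cross X Y (Z ⊗ A) = X ◁ cap e A.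
Proof.
have -> : (Y ◁ cross X Z A) \oc cross X Y (Z ⊗ A)
    = assoc Y Z (X ⊗ A) \oc cross X (Y ⊗ Z) A \oc (X ◁ assoc_inv Y Z A).
  rewrite cross_tensorl -!compA -whiskerl_comp assocKV tensorm1 compm1.
  by rewrite (comp_pre (assocKV _ _ _)) comp1m.
rewrite !capE -!compA (comp_pre (assocVK _ _ _)) comp1m.
rewrite (comp_pre (esym (cross_whiskerl _ _ _))) -!compA (comp_pre (unitl_cross _ _)).
by rewrite !whiskerl_comp.
Qed.

End Braid.

(** * Loops *)

Section Loop.
Variables (K : fieldType) (C : ribbonCategory K).
Implicit Types X Y Z W A B : C.

(** The trace of f, with the dual kept arbitrary so that loops around a tensor
    product can be closed with the tensor product of the duals. *)
Definition loop X D (e : hom (D ⊗ X) 𝟙) (c : hom 𝟙 (X ⊗ D)) (f : hom X X) A :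
    hom A A :=
  cap e A \oc cross X D A \oc ((twist X \oc f) ▷ (D ⊗ A)) \oc cup c A.

(** Slide f around the cup as its mate, through the crossing, and back around
    the cap.  For f = g = id it says that the trace does not depend on the
    dual. *)
Lemma loop_cyclic X DX Y DY
    (eX : hom (DX ⊗ X) 𝟙) (cX : hom 𝟙 (X ⊗ DX))
    (eY : hom (DY ⊗ Y) 𝟙) (cY : hom 𝟙 (Y ⊗ DY)) (f : hom X Y) (g : hom Y X) A :
  zigzagl eX cX -> zigzagl eY cY ->
  loop eX cX (g \oc f) A = loop eY cY (f \oc g) A.
Proof.
move=> zX zY; rewrite /loop [twist X \oc _]compA whiskerr_comp -!compA.
rewrite -(cup_mate cX f A zY) (comp_pre (whisker_exchange _ _)) -!compA.
rewrite (comp_pre (cross_whiskerl _ _ _)) -!compA (comp_pre (cap_mate eY f A zX)).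
rewrite -!compA (comp_pre (esym (cross_whiskerr _ _ _))) -!compA.
rewrite (comp_pre (esym (whiskerr_comp _ _ _))).
by rewrite [f \oc _]compA -twist_natural -compA.
Qed.

Lemma loop_qtrace X (f : hom X X) A :
  loop (ev X) (coev X) f A = unitl A \oc (qtrace f ▷ A) \oc unitl_inv A.
Proof.
rewrite /loop /cross -box_whiskerr box_cup (comp_pre (cap_box _ _ _)) cap_cup.
by rewrite /qtrace !compA.
Qed.

Section Tensor.
Variables (X X' Y Y' : C).
Variables (eX : hom (X' ⊗ X) 𝟙) (cX : hom 𝟙 (X ⊗ X')).
Variables (eY : hom (Y' ⊗ Y) 𝟙) (cY : hom 𝟙 (Y ⊗ Y')).

Lemma cross_tensor A :
  cross (Y ⊗ X) (Y' ⊗ X') A \oc assoc_inv Y X (Y' ⊗ X' ⊗ A)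
    \oc (Y ◁ (X ◁ assoc_inv Y' X' A))
  = (Y' ⊗ X' ◁ assoc_inv Y X A) \oc assoc_inv Y' X' (Y ⊗ (X ⊗ A))
      \oc (Y' ◁ cross Y X' (X ⊗ A)) \oc cross Y Y' (X' ⊗ (X ⊗ A))
      \oc (Y ◁ (Y' ◁ cross X X' A)) \oc (Y ◁ cross X Y' (X' ⊗ A)).
Proof.
rewrite cross_tensorr -!compA (comp_pre (assocKV _ _ _)) comp1m.
rewrite !(cross_tensorl _ Y' X') !whiskerl_comp -!compA.
congr (_ \oc (_ \oc (_ \oc (_ \oc _)))).
rewrite (comp_pre (whiskerl_cancel _ (assocKV _ _ _))) comp1m.
by rewrite (whiskerl_cancel _ (whiskerl_cancel _ (assocKV _ _ _))) compm1.
Qed.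

(** By naturality the second of the two braidings moves through the crossing of
    X tensor Y with its dual, up to the caps; there the strand Y is pulled off
    the cap of X, after which the strand X is pulled off the cap of Y. *)
Lemma cap_full_twist A :
  cap (tensor_ev eX eY) A \oc cross (X ⊗ Y) (Y' ⊗ X') A
    \oc ((braid Y X \oc braid X Y) ▷ (Y' ⊗ X' ⊗ A))
    \oc assoc_inv X Y (Y' ⊗ X' ⊗ A) \oc (X ◁ (Y ◁ assoc_inv Y' X' A))
  = cap (eX \oc braid X X') A \oc (X ◁ cap (eY \oc braid Y Y') (X' ⊗ A)).
Proof.
have crossE : (braid X Y ▷ (Y' ⊗ X' ⊗ A)) \oc assoc_inv X Y (Y' ⊗ X' ⊗ A)
    = assoc_inv Y X (Y' ⊗ X' ⊗ A) \oc cross X Y (Y' ⊗ X' ⊗ A).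
  by rewrite /cross boxE (comp_pre (assocVK _ _ _)) comp1m.
have slide V W (h : hom V W) : (Y' ⊗ X' ◁ h) \oc assoc_inv Y' X' V
    = assoc_inv Y' X' W \oc (Y' ◁ (X' ◁ h)) by rewrite assoc_inv_natural tensorm1.
rewrite whiskerr_comp -!compA (comp_pre (cross_whiskerr _ _ _)) -!compA.
rewrite (comp_pre crossE) -!compA cross_natural (comp_pre3 (cross_tensor _)).
rewrite -!compA cap_tensor_ev -!compA (comp_pre (slide _ _ _)) -!compA.
rewrite (comp_pre (slide _ _ _)) -!compA (comp_pre (assocKV _ _ _)) comp1m.
rewrite !(comp_pre (esym (whiskerl_comp _ _ _))) -!compA.
(* the braiding of Y and X, once moved through the crossing, meets the cap of X *)
have capE3 : (X' ◁ assoc X Y A) \oc (X' ◁ (braid Y X ▷ A)) \oc (X' ◁ assoc_inv Y X A)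
    = X' ◁ cross Y X A by rewrite -!whiskerl_comp /cross boxE.
rewrite (comp_pre3 capE3) cap_cross (comp_pre (esym (cross_natural _ _ _))) -!compA.
rewrite [Y ◁ (_ \oc _)]whiskerl_comp -!compA (comp_pre (cap_box eY _ _)).
rewrite (comp_pre (esym (whiskerl_comp _ _ _))) -whiskerl_comp cap_box.
rewrite (comp_pre (cap_natural _ _)) -!compA; congr (_ \oc _).
exact: cap_cross.
Qed.

Lemma loop_tensor A :
  loop (tensor_ev eX eY) (tensor_coev cX cY) (idm (X ⊗ Y)) A
  = cap (eX \oc braid X X') A \oc (twist X ▷ (X' ⊗ A))
      \oc (X ◁ loop eY cY (idm Y) (X' ⊗ A)) \oc cup cX A.
Proof.
have full W (k : hom W (X ⊗ (Y ⊗ (Y' ⊗ (X' ⊗ A))))) :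
    cap (tensor_ev eX eY) A \oc cross (X ⊗ Y) (Y' ⊗ X') A
      \oc ((braid Y X \oc braid X Y) ▷ (Y' ⊗ X' ⊗ A))
      \oc assoc_inv X Y (Y' ⊗ X' ⊗ A) \oc (X ◁ (Y ◁ assoc_inv Y' X' A)) \oc k
    = cap (eX \oc braid X X') A \oc (X ◁ cap (eY \oc braid Y Y') (X' ⊗ A)) \oc k.
  by rewrite [RHS]compA -cap_full_twist -!compA.
rewrite /loop !compm1 twist_tensor.
rewrite [braid Y X \oc _]compA whiskerr_comp cup_tensor_coev -!compA.
rewrite (comp_pre (esym (assoc_inv_natural _ _ _))).
rewrite (tensorm_whisker (twist X) (twist Y ▷ _)) -!compA.
rewrite (comp_pre (esym (whiskerl_comp X (twist Y ▷ _) _))).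
rewrite (comp_pre (whisker_exchange (twist Y) _)) !(whiskerl_comp X) -!compA.
do 4!rewrite ?(comp_pre (whisker_exchange (twist X) _)) -?compA.
by rewrite full -(cap_box eY) (whiskerl_comp X) -!compA.
Qed.

End Tensor.
End Loop.

(** * Dimensions of morphism spaces *)

Section LinearDimension.
Variable K : fieldType.

Lemma linear_injective_dim (V W : vectType K) (f : V -> W) :
  (forall a u v, f (a *: u + v) = a *: f u + f v) -> injective f ->
  (\dim {: V} <= \dim {: W})%N.
Proof.
move=> f_lin f_inj.
pose F := HB.pack f (GRing.isLinear.Build K V W *:%R f f_lin) : {linear V -> W}.
have ker0 : lker (linfun F) == 0%VS.
  by apply/lker0P => u v; rewrite !lfunE => /f_inj.
rewrite -(limg_dim_eq (f := linfun F) (U := fullv)); first exact/dimvS/subvf.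
by rewrite (eqP ker0) capv0.
Qed.

Lemma linear_bijective_dim (V W : vectType K) (f : V -> W) (g : W -> V) :
  (forall a u v, f (a *: u + v) = a *: f u + f v) ->
  (forall a u v, g (a *: u + v) = a *: g u + g v) ->
  cancel f g -> cancel g f -> \dim {: V} = \dim {: W}.
Proof.
move=> f_lin g_lin fK gK; apply/eqP; rewrite eqn_leq.
by rewrite (linear_injective_dim f_lin (can_inj fK))
           (linear_injective_dim g_lin (can_inj gK)).
Qed.

End LinearDimension.

Section HomIso.
Variables (K : fieldType) (C : linearCategory K).
Implicit Types X Y Z : C.

Lemma dim_hom_isol X X' Z :
  isomorphic X X' -> \dim {: hom X Z} = \dim {: hom X' Z}.
Proof.
case=> f [g [gf fg]].
apply: (@linear_bijective_dim _ _ _ (fun h => h \oc g) (fun h => h \oc f)).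
- by move=> a u v; rewrite comp_linearl.
- by move=> a u v; rewrite comp_linearl.
- by move=> h; rewrite -compA gf compm1.
- by move=> h; rewrite -compA fg compm1.
Qed.

Lemma dim_hom_isor X Z Z' :
  isomorphic Z Z' -> \dim {: hom X Z} = \dim {: hom X Z'}.
Proof.
case=> f [g [gf fg]].
apply: (@linear_bijective_dim _ _ _ (fun h => f \oc h) (fun h => g \oc h)).
- by move=> a u v; rewrite comp_linearr.
- by move=> a u v; rewrite comp_linearr.
- by move=> h; rewrite compA gf comp1m.
- by move=> h; rewrite compA fg comp1m.
Qed.

End HomIso.

Section Adjunction.
Variables (K : fieldType) (C : monoidalCategory K).
Variables (Y D : C) (e : hom (D ⊗ Y) 𝟙) (c : hom 𝟙 (Y ⊗ D)).
Implicit Types X Z A : C.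

Definition curry X Z (f : hom (X ⊗ Y) Z) : hom X (Z ⊗ D) :=
  (f ▷ D) \oc assoc_inv X Y D \oc (X ◁ c) \oc unitr_inv X.

Definition uncurry X Z (g : hom X (Z ⊗ D)) : hom (X ⊗ Y) Z :=
  unitr Z \oc (Z ◁ e) \oc assoc Z D Y \oc (g ▷ Y).

(** Both transposes are compared with the strand calculus, where the triangle
    identities are available in the form [zigzagl] and [zigzagr]. *)
Lemma curry_whiskerr X Z (f : hom (X ⊗ Y) Z) A :
  curry f ▷ A
  = assoc_inv Z D A \oc (f ▷ (D ⊗ A)) \oc assoc_inv X Y (D ⊗ A)
      \oc (X ◁ cup c A).
Proof.
rewrite /curry !whiskerr_comp cupE !whiskerl_comp.
rewrite (comp_pre (pentagon_inv_whiskerl _ _ _ _)) -!compA.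
rewrite (comp_pre (assoc_inv_natural _ _ _)) -!compA assoc_inv_unitl_inv.
rewrite -[f ▷ (D ⊗ A)]box_whiskerr boxE -!compA.
by rewrite (comp_pre (assocVK _ _ _)) comp1m (comp_pre (assocVK _ _ _)) comp1m.
Qed.

Lemma uncurry_whiskerr X Z (g : hom X (Z ⊗ D)) A :
  uncurry g ▷ A
  = (Z ◁ cap e A) \oc assoc Z D (Y ⊗ A) \oc (g ▷ (Y ⊗ A)) \oc assoc X Y A.
Proof.
rewrite /uncurry !whiskerr_comp capE !whiskerl_comp.
rewrite -[g ▷ (Y ⊗ A)]box_whiskerr boxE -!compA assocVK compm1.
rewrite (comp_pre (pentagon_inv _ _ _ _)) -!compA (comp_pre (assocVK _ _ _)) comp1m.
by rewrite (comp_pre (esym (assoc_natural _ _ _))) -!compA (comp_pre (triangle _ _)).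
Qed.

Lemma curryK X Z (f : hom (X ⊗ Y) Z) :
  zigzagl e c -> uncurry (curry f) = f.
Proof.
move=> z; apply: whiskerr1I; rewrite uncurry_whiskerr curry_whiskerr -!compA.
rewrite (comp_pre (assocKV _ _ _)) comp1m.
rewrite (comp_pre (esym (whisker_exchange _ _))) -!compA.
rewrite -[idm (X ⊗ Y)]tensorm1 (comp_pre (esym (assoc_inv_natural _ _ _))).
rewrite -!compA (comp_pre (whiskerl_cancel _ (z _))) comp1m assocVK.
exact: compm1.
Qed.

Lemma uncurryK X Z (g : hom X (Z ⊗ D)) :
  zigzagr e c -> curry (uncurry g) = g.
Proof.
move=> z; apply: whiskerr1I; rewrite curry_whiskerr uncurry_whiskerr -!compA.
rewrite (comp_pre (assocKV _ _ _)) comp1m.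
rewrite whisker_exchange -[idm (Z ⊗ D)]tensorm1 (comp_pre (assoc_natural _ _ _)).
rewrite -!compA (comp_pre (whiskerl_cancel _ (z _))) comp1m.
by rewrite (comp_pre (assocVK _ _ _)) comp1m.
Qed.

Lemma dim_adjunction X Z :
  is_left_dual e c -> \dim {: hom (X ⊗ Y) Z} = \dim {: hom X (Z ⊗ D)}.
Proof.
move=> dualYD; apply: (@linear_bijective_dim _ _ _ (@curry X Z) (@uncurry X Z)).
- move=> a u v; rewrite /curry tensorm_linearl.
  by rewrite comp_linearl.
- move=> a u v; rewrite /uncurry tensorm_linearl.
  by rewrite !comp_linearr.
- by move=> f; apply/curryK/left_dual_zigzagl.
- by move=> g; apply/uncurryK/left_dual_zigzagr.
Qed.

End Adjunction.

Section CompLinear.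
Variables (K : fieldType) (C : linearCategory K) (X Y Z : C).

Definition precomp (f : hom X Y) (g : hom Y Z) := g \oc f.
Definition postcomp (g : hom Y Z) (f : hom X Y) := g \oc f.

HB.instance Definition _ f :=
  GRing.isLinear.Build K (hom Y Z) (hom X Z) *:%R (precomp f)
    (fun a g g' => comp_linearl a g g' f).
HB.instance Definition _ g :=
  GRing.isLinear.Build K (hom X Y) (hom X Z) *:%R (postcomp g)
    (fun a f f' => comp_linearr a g f f').

Lemma comp0m (f : hom X Y) : (0 : hom Y Z) \oc f = 0.
Proof. exact: (linear0 (precomp f)). Qed.
Lemma compm0 (g : hom Y Z) : g \oc (0 : hom X Y) = 0.
Proof. exact: (linear0 (postcomp g)). Qed.
Lemma compmB (g : hom Y Z) (f f' : hom X Y) :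
  g \oc (f - f') = g \oc f - g \oc f'.
Proof. exact: (linearB (postcomp g)). Qed.
Lemma compZm a (g : hom Y Z) (f : hom X Y) : (a *: g) \oc f = a *: (g \oc f).
Proof. exact: (linearZ_LR (precomp f)). Qed.
Lemma compmZ a (g : hom Y Z) (f : hom X Y) : g \oc (a *: f) = a *: (g \oc f).
Proof. exact: (linearZ_LR (postcomp g)). Qed.
Lemma comp_suml I (r : seq I) (P : pred I) (g : I -> hom Y Z) (f : hom X Y) :
  (\sum_(i <- r | P i) g i) \oc f = \sum_(i <- r | P i) g i \oc f.
Proof. exact: (linear_sum (precomp f)). Qed.
Lemma comp_sumr I (r : seq I) (P : pred I) (g : hom Y Z) (f : I -> hom X Y) :
  g \oc (\sum_(i <- r | P i) f i) = \sum_(i <- r | P i) g \oc f i.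
Proof. exact: (linear_sum (postcomp g)). Qed.

End CompLinear.

Section DirectSumDimension.
Variable K : fieldType.

Lemma dim_direct_sum m (V : vectType K) (W : 'I_m -> vectType K)
    (inj : forall i, {linear W i -> V}) (proj : forall i, {linear V -> W i}) :
  (forall i, cancel (inj i) (proj i)) ->
  (forall i j, i != j -> forall w, proj j (inj i w) = 0) ->
  (forall v, \sum_i inj i (proj i v) = v) ->
  \dim {: V} = (\sum_i \dim {: W i})%N.
Proof.
move=> injK orth total.
pose U i := limg (linfun (inj i)).
have dimU i : \dim (U i) = \dim {: W i}.
  rewrite limg_dim_eq //; have /eqP -> : lker (linfun (inj i)) == 0%VS.
    by apply/lker0P => u v; rewrite !lfunE => /(can_inj (injK i)).
  by rewrite capv0.
have -> : fullv = (\sum_i U i)%VS.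
  apply/eqP; rewrite eqEsubv subvf andbT; apply/subvP => v _.
  rewrite -[v]total; apply: memv_sumr => i _.
  by rewrite -[inj i _](lfunE (inj i)) memv_img ?memvf.
have -> : (\sum_i \dim {: W i})%N = (\sum_i \dim (U i))%N.
  by apply: eq_bigr => i _; rewrite dimU.
apply/eqP; rewrite -[_ == _]/(directv (\sum_i U i)).
apply/directv_sum_independent => us usU us0 i _.
have /memv_imgP [w _ usw] := usU i isT; rewrite usw lfunE /=.
have : proj i (\sum_j us j) = 0 by rewrite us0 linear0.
rewrite linear_sum (bigD1 i) //= big1 ?addr0 => [|j ji].
  by rewrite usw lfunE /= injK => ->; rewrite linear0.
by have /memv_imgP [w' _ ->] := usU j isT; rewrite lfunE /= orth.
Qed.

End DirectSumDimension.

Section DirectSum.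
Variables (K : fieldType) (C : linearCategory K).
Implicit Types X Y Z : C.

Lemma dim_hom_suml m (S : 'I_m -> C) Z X : is_direct_sum S Z ->
  \dim {: hom X Z} = (\sum_i \dim {: hom X (S i)})%N.
Proof.
case=> inj [proj [injK orth total]].
apply: (@dim_direct_sum _ _ _ _ (fun i => postcomp (inj i) : {linear _ -> _})
   (fun i => postcomp (proj i) : {linear _ -> _})).
- by move=> i f; rewrite /= /postcomp compA injK comp1m.
- by move=> i j ij f; rewrite /= /postcomp compA orth // comp0m.
- move=> f; rewrite /= /postcomp -[RHS]comp1m -total comp_suml.
  by apply: eq_bigr => i _; rewrite compA.
Qed.

Lemma dim_hom_sumr m (S : 'I_m -> C) Z X : is_direct_sum S Z ->
  \dim {: hom Z X} = (\sum_i \dim {: hom (S i) X})%N.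
Proof.
case=> inj [proj [injK orth total]].
apply: (@dim_direct_sum _ _ _ _ (fun i => precomp (proj i) : {linear _ -> _})
   (fun i => precomp (inj i) : {linear _ -> _})).
- by move=> i f; rewrite /= /precomp -compA injK compm1.
- by move=> i j ij f; rewrite /= /precomp -compA orth 1?eq_sym // compm0.
- move=> f; rewrite /= /precomp -[RHS]compm1 -total comp_sumr.
  by apply: eq_bigr => i _; rewrite compA.
Qed.

Lemma isomorphic_sym X Y : isomorphic X Y -> isomorphic Y X.
Proof. by case=> f [g [gf fg]]; exists g, f. Qed.

Lemma isomorphic_trans X Y Z :
  isomorphic X Y -> isomorphic Y Z -> isomorphic X Z.
Proof.
case=> f [f' [f'f ff']] [g [g' [g'g gg']]]; exists (g \oc f), (f' \oc g').
by split; rewrite -!compA ?(comp_pre g'g) ?(comp_pre ff') comp1m.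
Qed.

End DirectSum.

(** * Schur's lemma and semisimplicity *)

Import passmx.

Section Schur.
Variables (K : numClosedFieldType) (C : linearCategory K).
Hypothesis abelC : abelian_category C.
Implicit Types X Y Z : C.

(** The kernel of f is 0, since it is not an isomorphism; so f is a nonzero
    monomorphism into a simple object. *)
Lemma schur_iso X Y (f : hom X Y) :
  simple_object X -> simple_object Y -> f <> 0 -> is_iso f.
Proof.
move=> [_ subX] [_ subY] f0; case: abelC => _ kernels _ _ _.
have [Z [k [fk0 univ]]] := kernels _ _ f.
have k_mono : is_mono k.
  move=> W g h kgh; have [|l [_ uniq]] := univ W (k \oc g).
    by rewrite compA fk0 comp0m.
  by rewrite -(uniq g) // -(uniq h).
case: (subX _ k k_mono) => [k0 | [k' [_ kk']]]; last first.
  by case: f0; rewrite -[f]compm1 -kk' compA fk0 comp0m.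
have f_mono : is_mono f.
  move=> W g h fgh; have [|l [klE _]] := univ W (g - h).
    by rewrite compmB fgh subrr.
  by apply/eqP; rewrite -subr_eq0 -klE k0 comp0m.
by case: (subY _ f f_mono).
Qed.

(** Composition with f on the finite-dimensional space End(X) has an
    eigenvector g; it is invertible, so f is the eigenvalue. *)
Lemma schur_scalar X (f : hom X X) :
  simple_object X -> exists t, f = t *: idm X.
Proof.
move=> simX; have [X0 _] := simX.
pose F := linfun (postcomp f : {linear hom X X -> hom X X}).
pose e := vbasis {: hom X X}; have eB := vbasisP {: hom X X}.
have dim_gt0 : (0 < \dim {: hom X X})%N.
  rewrite lt0n dimv_eq0; apply/eqP => E; case: X0; apply/eqP.
  by rewrite -memv0 -E memvf.
have [t /eigenvalueP [v vE v0]] := eigenvalue_closed (mxof e e F) dim_gt0.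
exists t; have := hom_vecof e eB F v; rewrite vE linearZ /=.
set g := vecof e v; rewrite lfunE /= /postcomp => fg.
have g0 : g <> 0 by apply/eqP; rewrite vecof_eq0.
have [g' [_ gg']] := schur_iso simX simX g0.
by rewrite -[f]compm1 -gg' compA fg compZm.
Qed.

Lemma dim_hom_simple X Y : simple_object X -> simple_object Y ->
  \dim {: hom X Y} = `[< isomorphic X Y >].
Proof.
move=> simX simY; case: asboolP => [isoXY | nisoXY].
  rewrite -(dim_hom_isor X isoXY).
  have -> : fullv = <[idm X]>%VS; last first.
    by rewrite dim_vline; case: eqP => //; case: simX.
  apply/eqP; rewrite eqEsubv subvf andbT; apply/subvP => f _.
  by have [t ->] := schur_scalar f simX; rewrite memvZ ?memv_line.
apply/eqP; rewrite dimv_eq0 -subv0; apply/subvP => f _; rewrite memv0.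
by apply/negPn/negP => /eqP f0; case: nisoXY; exists f; apply: schur_iso.
Qed.

Hypothesis decompC : forall Z : C, exists m (X : 'I_m -> C),
  (forall i, simple_object (X i)) /\ is_direct_sum X Z.

(** Both sides count the summands of Z that are isomorphic to X. *)
Lemma dim_hom_simple_sym X Z : simple_object X ->
  \dim {: hom X Z} = \dim {: hom Z X}.
Proof.
move=> simX; have [m [S [simS sumZ]]] := decompC Z.
rewrite (dim_hom_suml _ sumZ) (dim_hom_sumr _ sumZ); apply: eq_bigr => i _.
rewrite !dim_hom_simple //; congr (nat_of_bool _).
by apply: asbool_equiv_eq; split; apply: isomorphic_sym.
Qed.

(** End(Z) is the sum of the Hom(Z, S_i) over the simple summands S_i of Z, and
    none of these is 0; so there is exactly one summand. *)
Lemma simple_of_dim_end Z : \dim {: hom Z Z} = 1%N ->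
  exists2 X, simple_object X & isomorphic Z X.
Proof.
move=> dimZ; have [m [S [simS sumZ]]] := decompC Z.
have dimS i : (1 <= \dim {: hom Z (S i)})%N.
  rewrite (dim_hom_sumr _ sumZ) (bigD1 i) //= dim_hom_simple //.
  case: asboolP => // -[]; exists (idm (S i)), (idm (S i)).
  by split; rewrite comp1m.
have /eqP m1 : m == 1%N.
  rewrite eqn_leq -{1}dimZ (dim_hom_suml _ sumZ) -[X in (X <= _)%N]card_ord.
  rewrite -sum1_card leq_sum //=.
  by case: m S {simS dimS} sumZ => [|//] S sumZ; have := dim_hom_suml Z sumZ;
     rewrite big_ord0 dimZ.
subst m; exists (S ord0) => //; case: sumZ => inj [proj [injK _ total]].
by exists (proj ord0), (inj ord0); split; rewrite // -total big_ord1.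
Qed.

End Schur.

(** * Quantum dimensions *)

Section TensorLinear.
Variables (K : fieldType) (C : monoidalCategory K) (X X' Y Y' : C).

Definition tensor_with (g : hom Y Y') (f : hom X X') := f ⊠ g.

HB.instance Definition _ g :=
  GRing.isLinear.Build K (hom X X') (hom (X ⊗ Y) (X' ⊗ Y')) *:%R (tensor_with g)
    (fun a f f' => tensorm_linearl a f f' g).

Lemma tensormZl a (f : hom X X') (g : hom Y Y') : (a *: f) ⊠ g = a *: (f ⊠ g).
Proof. exact: (linearZ_LR (tensor_with g)). Qed.

Lemma tensorm_suml I (r : seq I) (P : pred I) (f : I -> hom X X') (g : hom Y Y') :
  (\sum_(i <- r | P i) f i) ⊠ g = \sum_(i <- r | P i) f i ⊠ g.
Proof. exact: (linear_sum (tensor_with g)). Qed.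

End TensorLinear.

Section WhiskerLinear.
Variables (K : fieldType) (C : monoidalCategory K) (X Y Y' : C).

Lemma whiskerlZ a (g : hom Y Y') : X ◁ (a *: g) = a *: (X ◁ g).
Proof.
have T0 : X ◁ (0 : hom Y Y') = 0.
  have := tensorm_linearr (-1) (idm X) (0 : hom Y Y') 0.
  by rewrite scaler0 addr0 scaleN1r addNr.
by rewrite -[a *: g]addr0 tensorm_linearr T0 addr0.
Qed.

End WhiskerLinear.

Section QuantumDimension.
Variables (K : numClosedFieldType) (C : ribbonCategory K).
Hypothesis abelC : abelian_category C.
Hypothesis unit_simple : simple_object (𝟙 : C).
Implicit Types X Y Z A : C.

Lemma scalar_ofE X (f : hom X X) t : idm X <> 0 -> f = t *: idm X -> scalar_of f = t.
Proof.
move=> X0 ->; rewrite /scalar_of; apply: xget_unique => //= u /eqP.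
by rewrite -subr_eq0 -scalerBl scaler_eq0 subr_eq0 => /orP[/eqP // | /eqP].
Qed.

(** The trace is a scalar by Schur's lemma for the unit, so the chosen scalar
    in the definition of [qdim] is the actual one. *)
Lemma loop_qdim X A : loop (ev X) (coev X) (idm X) A = qdim X *: idm A.
Proof.
rewrite loop_qtrace.
have [t qtraceE] := schur_scalar abelC (qtrace (idm X)) unit_simple.
rewrite /qdim (scalar_ofE _ qtraceE) ?qtraceE; last by case: unit_simple.
by rewrite tensormZl tensorm1 compZm comp1m compmZ unitlKV.
Qed.

Lemma qdim_loop X D (e : hom (D ⊗ X) 𝟙) (c : hom 𝟙 (X ⊗ D)) t :
  zigzagl e c -> loop e c (idm X) 𝟙 = t *: idm 𝟙 -> qdim X = t.
Proof.
move=> z loopE; have z' := left_dual_zigzagl (dualP X).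
have := loop_cyclic (idm X) (idm X) 𝟙 z z'.
rewrite !comp1m loopE loop_qdim => /eqP.
rewrite -subr_eq0 -scalerBl scaler_eq0 subr_eq0 => /orP[/eqP // | /eqP].
by case: unit_simple.
Qed.

Lemma qdim_tensor X Y : qdim (X ⊗ Y) = qdim X * qdim Y.
Proof.
apply: (@qdim_loop _ _ (tensor_ev (ev X) (ev Y)) (tensor_coev (coev X) (coev Y))).
  by apply: tensor_zigzagl; apply/left_dual_zigzagl/dualP.
rewrite loop_tensor loop_qdim whiskerlZ tensorm1 compZm comp1m !compmZ.
have := loop_qdim X 𝟙; rewrite /loop compm1 /cross (comp_pre (cap_box _ _ _)) => ->.
by rewrite scalerA mulrC.
Qed.

Lemma qdim_iso X Y : isomorphic X Y -> qdim X = qdim Y.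
Proof.
case=> f [g [gf fg]]; apply: (qdim_loop (left_dual_zigzagl (dualP X))).
rewrite -gf (@loop_cyclic _ _ _ _ _ _ _ _ (ev Y) (coev Y)).
- by rewrite fg loop_qdim.
- exact/left_dual_zigzagl/dualP.
- exact/left_dual_zigzagl/dualP.
Qed.

(** The identity of Z is the sum of the inj_i proj_i, and by cyclicity the trace
    of inj_i proj_i is that of proj_i inj_i = id. *)
Lemma qdim_direct_sum m (S : 'I_m -> C) Z :
  is_direct_sum S Z -> qdim Z = \sum_i qdim (S i).
Proof.
case=> inj [proj [injK _ total]]; apply: (qdim_loop (left_dual_zigzagl (dualP Z))).
rewrite -total /loop comp_sumr tensorm_suml comp_suml !comp_sumr scaler_suml.
apply: eq_bigr => i _; rewrite -[LHS]/(loop _ _ _ _).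
rewrite (@loop_cyclic _ _ _ _ _ _ _ _ (ev (S i)) (coev (S i))).
- by rewrite injK loop_qdim.
- exact/left_dual_zigzagl/dualP.
- exact/left_dual_zigzagl/dualP.
Qed.

End QuantumDimension.

(** * The fusion rules of the category *)

Section FusionData.
Variables (K : numClosedFieldType) (C : ribbonCategory K).
Hypothesis semiC : semisimple_category C.
Hypothesis unit_simple : simple_object (𝟙 : C).
Implicit Types X Y Z A : C.

Lemma tensor_isol X X' Y : isomorphic X X' -> isomorphic (X ⊗ Y) (X' ⊗ Y).
Proof. by case=> f f_iso; exists (f ▷ Y); apply: whiskerr_iso. Qed.

Lemma tensor_isor X Y Y' : isomorphic Y Y' -> isomorphic (X ⊗ Y) (X ⊗ Y').
Proof. by case=> f f_iso; exists (X ◁ f); apply: whiskerl_iso. Qed.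

Lemma unitl_isomorphic X : isomorphic (𝟙 ⊗ X) X.
Proof. by exists (unitl X); apply: (is_iso_mutual_inverse (unitlK X)). Qed.

Lemma braid_isomorphic X Y : isomorphic (X ⊗ Y) (Y ⊗ X).
Proof. by exists (braid X Y); apply: braid_iso. Qed.

(** By adjunction, End(X* ) has the dimension of Hom(X* tensor X, 1), and End(X)
    that of Hom(1, X tensor X* ); the braiding and [dim_hom_simple_sym] identify
    them. *)
Lemma dual_simple X : simple_object X ->
  exists2 Y, simple_object Y & isomorphic (dual X) Y.
Proof.
move=> simX; have [abelC decompC] := semiC.
apply: simple_of_dim_end => //.
rewrite -(dim_hom_isor _ (unitl_isomorphic (dual X))) -(dim_adjunction _ _ (dualP X)).
rewrite (dim_hom_isol _ (braid_isomorphic _ _)) -(dim_hom_simple_sym abelC) //.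
rewrite -(dim_adjunction _ _ (dualP X)) (dim_hom_isol _ (unitl_isomorphic X)).
rewrite dim_hom_simple //; case: asboolP => // -[].
by exists (idm X), (idm X); split; rewrite comp1m.
Qed.

Variables (n : nat) (X : 'I_n -> C).
Hypothesis repX : simple_representatives X.

Let simX i : simple_object (X i). Proof. by case: repX. Qed.

Lemma qdim_decomposition Z :
  qdim Z = \sum_k (\dim {: hom Z (X k)})%:R * qdim (X k).
Proof.
have [abelC decompC] := semiC; have [_ injX surjX] := repX.
have [m [S [simS sumZ]]] := decompC Z.
rewrite (qdim_direct_sum abelC unit_simple sumZ).
transitivity (\sum_(a < m) \sum_k (\dim {: hom (S a) (X k)})%:R * qdim (X k)).
  apply: eq_bigr => a _; have [k isok] := surjX _ (simS a).
  rewrite (bigD1 k) //= dim_hom_simple // asboolT // mul1r.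
  rewrite (qdim_iso abelC unit_simple isok) big1 ?addr0 // => j /eqP jk.
  rewrite dim_hom_simple // asboolF ?mul0r // => isoj; case: jk.
  by apply: injX; apply: isomorphic_trans isok; apply: isomorphic_sym.
rewrite exchange_big; apply: eq_bigr => k _ /=.
by rewrite (dim_hom_sumr _ sumZ) natr_sum mulr_suml.
Qed.

Lemma qdim_int :
  (forall Y, simple_object Y -> 0 < qdim Y) ->
  (forall Y, simple_object Y -> (isomorphic Y (dual Y) <-> isomorphic Y 𝟙)) ->
  forall i, exists m : int, qdim (X i) = m%:~R.
Proof.
move=> qdim_gt0 self_dual; have [abelC decompC] := semiC.
have [_ injX surjX] := repX.
have dual_index j : exists k, isomorphic (dual (X j)) (X k).
  have [Y simY isoY] := dual_simple (simX j); have [k isok] := surjX _ simY.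
  by exists k; apply: isomorphic_trans isok.
have [s sP] := choice dual_index.
have [o oP] := surjX _ unit_simple.
have isoXE i j : `[< isomorphic (X i) (X j) >] = (i == j).
  apply/asboolP/eqP => [/injX // | ->].
  by exists (idm (X j)), (idm (X j)); split; rewrite comp1m.
apply: (@fusion_dim_integral _ n
  (fun i j k => fusion_coef (X i) (X j) (X k)) s o (fun i => qdim (X i))).
- move=> j k; rewrite /fusion_coef (dim_hom_isol _ (tensor_isol _ (isomorphic_sym oP))).
  by rewrite (dim_hom_isol _ (unitl_isomorphic _)) dim_hom_simple // isoXE.
- by move=> i j k; rewrite /fusion_coef (dim_hom_isol _ (braid_isomorphic _ _)).
- move=> i j k; rewrite /fusion_coef (dim_adjunction _ _ (dualP _)).
  by rewrite (dim_hom_isor _ (tensor_isor _ (sP j))) (dim_hom_simple_sym abelC).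
- move=> i; have [sd ds] := self_dual _ (simX i); split=> [si | ->].
    apply: injX; apply: isomorphic_trans oP; apply: sd; apply: isomorphic_sym.
    by rewrite -{2}si.
  have [_] := self_dual _ (simX o).
  move=> /(_ (isomorphic_sym oP)) isoo; apply: injX.
  by apply: isomorphic_sym; apply: isomorphic_trans isoo (sP o).
- move=> i j; rewrite -qdim_tensor //; exact: qdim_decomposition.
- by move=> i; apply: qdim_gt0.
Qed.

End FusionData.

Theorem theorem2p2 (R : realType) (C : modularCategory R) (n : nat)
    (hpos : forall X : C, simple_object X -> 0 < qdim X)
    (hrank : has_rank C n) (hodd : odd n)
    (hdual : forall X : C, simple_object X ->
       (isomorphic X (dual X) <-> isomorphic X (𝟙 : C))) :
  forall X : C, simple_object X -> exists m : int, qdim X = m%:~R.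
Proof.
have [X repX] := hrank; have [_ _ surjX] := repX.
move=> Y simY; have [i isoi] := surjX _ simY.
have [abelC _] := modular_semisimple C.
rewrite (qdim_iso abelC (modular_unit_simple C) isoi).
by apply: qdim_int => //; [apply: modular_semisimple | apply: modular_unit_simple].
Qed.
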